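(* For every graph $G$ with maximum degree $\Delta\le 5$, \[ \chi'_D(G)\le \frac{1}{2}\Delta^2+\frac{1}{2}\Delta . \]
   Context: All graphs are finite and simple. A diamond is the graph on four vertices with exactly five edges (i.e. $K_4$ minus one edge); a diamond subgraph of $G$ is a (not necessarily induced) subgraph of $G$ isomorphic to the diamond. In an edge-colored graph, a subgraph is rainbow if all of its edges have pairwise distinct colors. A D-coloring of $G$ is a proper edge coloring of $G$ (edges sharing an endpoint get different colors) such that every diamond subgraph of $G$ is rainbow. The D-chromatic index $\chi'_D(G)$ is the minimum number of colors needed for a D-coloring of $G$. *)

(* Defs.v *)
From mathcomp Require Import all_boot.

Set Implicit Arguments.
Unset Strict Implicit.
Unset Printing Implicit Defensive.

Record sgraph := SGraph {
  vertex :> finType;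
  adj : rel vertex;
  adj_sym : symmetric adj;
  adj_irr : irreflexive adj
}.

Definition degree (G : sgraph) (x : G) : nat := #|[set y | adj x y]|.

Definition max_degree (G : sgraph) : nat := \max_(x : G) degree x.

Definition edges (G : sgraph) : {set {set G}} :=
  [set e : {set G} | [exists x, exists y, adj x y && (e == [set x; y])]].

Definition edge (G : sgraph) : finType := {e : {set G} | e \in edges G}.

Definition isomorphic (G H : sgraph) : bool :=
  [exists f : {ffun G -> H},
    [&& injectiveb f, [forall y, exists x, f x == y]
      & [forall x, forall y, adj (f x) (f y) == adj x y]]].

(* A subgraph of G is a pair (V, F) of a vertex set and an edge set such that
   the ends of the edges in F lie in V; it need not be induced. *)
Definition is_subgraph (G : sgraph) (V : {set G}) (F : {set edge G}) : bool :=
  [forall e in F, val e \subset V].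

Definition sub_adj (G : sgraph) (V : {set G}) (F : {set edge G}) :
    rel {x : G | x \in V} :=
  fun x y => [exists e in F, val e == [set val x; val y]].

Lemma sub_adj_sym (G : sgraph) (V : {set G}) (F : {set edge G}) :
  symmetric (@sub_adj G V F).
Proof. by move=> x y; rewrite /sub_adj setUC. Qed.

Lemma sub_adj_irr (G : sgraph) (V : {set G}) (F : {set edge G}) :
  irreflexive (@sub_adj G V F).
Proof.
move=> x; apply/negbTE/existsP => -[[e eE]] /andP[_ /eqP /= eq_e].
move: eE; rewrite inE eq_e setUid => /existsP[y /existsP[z /andP[yz /eqP eq_yz]]].
have := set21 y z; have := set22 y z.
rewrite -eq_yz !inE => /eqP eq_z /eqP eq_y.
by rewrite eq_y eq_z adj_irr in yz.
Qed.

Definition subgraph (G : sgraph) (V : {set G}) (F : {set edge G}) : sgraph :=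
  SGraph (@sub_adj_sym G V F) (@sub_adj_irr G V F).

(* K_4 on the vertices 0, 1, 2, 3 without the edge {2, 3}. *)
Definition diamond_adj : rel 'I_4 :=
  fun i j => (i != j) && ~~ ((2 <= i) && (2 <= j)).

Lemma diamond_adj_sym : symmetric diamond_adj.
Proof. by move=> i j; rewrite /diamond_adj eq_sym andbC [X in ~~ X]andbC andbC. Qed.

Lemma diamond_adj_irr : irreflexive diamond_adj.
Proof. by move=> i; rewrite /diamond_adj eqxx. Qed.

Definition diamond : sgraph := SGraph diamond_adj_sym diamond_adj_irr.

Definition proper (G : sgraph) (C : finType) (c : {ffun edge G -> C}) : bool :=
  [forall e1 : edge G, forall e2 : edge G,
    (e1 != e2) && (val e1 :&: val e2 != set0) ==> (c e1 != c e2)].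

Definition rainbow (G : sgraph) (C : finType) (c : {ffun edge G -> C})
    (F : {set edge G}) : bool :=
  dinjectiveb c F.

Definition D_coloring (G : sgraph) (C : finType) (c : {ffun edge G -> C}) :
    bool :=
  proper c &&
  [forall V : {set G}, forall F : {set edge G},
    is_subgraph V F && isomorphic (subgraph V F) diamond ==> rainbow c F].

(* Only edges are colored, so that an edgeless graph is D_colorable with no
   color at all. *)
Definition D_colorable (G : sgraph) (k : nat) : bool :=
  [exists c : {ffun edge G -> 'I_k}, D_coloring c].

Lemma D_colorable_card (G : sgraph) : exists k, D_colorable G k.
Proof.
exists #|edge G|; apply/existsP; exists [ffun e => enum_rank e].
apply/andP; split.
  apply/forallP => e1; apply/forallP => e2; apply/implyP => /andP[ne12 _].
  by rewrite !ffunE (inj_eq enum_rank_inj).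
apply/forallP => V; apply/forallP => F; apply/implyP => _.
by apply/dinjectiveP => e1 e2 _ _; rewrite !ffunE => /enum_rank_inj.
Qed.

Definition D_chromatic_index (G : sgraph) : nat := ex_minn (D_colorable_card G).

(* Main.v *)
(* Two edges conflict if they share an end, or if they are disjoint and lie in
   a common diamond; a D-coloring is a proper coloring of the conflict graph.
   Write D for the maximum degree and k = D(D+1)/2.  For an edge xy with t
   common neighbours, counting conflicts gives at most k conflicting edges,
   with equality only if D = 5, deg x = 5 and t = 3, or if D = 4 and the
   neighbourhood of xy is that of an edge of the octahedron.  So greedy coloring
   succeeds unless some conflict-closed set S of edges has all conflict degrees
   equal to k.  If D = 5, a vertex x incident to S then has a 3-regular
   neighbourhood on 5 vertices, against the handshake lemma.  If D = 4, then S
   contains a whole component of G which is an octahedron, and this is colored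
   separately, with 6 colors. *)
Require Import Defs.
From mathcomp Require Import all_boot all_order all_algebra.
From mathcomp Require Import zify.

Set Implicit Arguments.
Unset Strict Implicit.
Unset Printing Implicit Defensive.

(** * Greedy coloring and gluing of colorings *)

Section Colorable.
Variables (T : finType) (r : rel T).

(** Colors are natural numbers, bounded on [S] only, so that the empty set is colorable even with
    [k = 0]. *)
Definition colorable (k : nat) (S : {set T}) : Prop :=
  exists2 c : T -> nat, {in S, forall e, c e < k}
    & {in S &, forall e f, r e f -> c e != c f}.

Lemma colorable_setD1 (k : nat) (S : {set T}) (v : T) :
  symmetric r -> irreflexive r -> #|[set w in S | r v w]| < k ->
  colorable k (S :\ v) -> colorable k S.
Proof.
move=> r_sym r_irr deg_v [c c_lt c_ok].
pose used := [set i : 'I_k | [exists w in S, r v w && (c w == i)]].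
have : #|used| < k.
  apply: leq_ltn_trans deg_v.
  (* Some values of [c] may lie outside ['I_k]; [insub] sends those to [None], and the image still
     covers every used color. *)
  apply: leq_trans (leq_imset_card (fun w => insub (c w) : option 'I_k) _).
  rewrite -(card_imset _ (@Some_inj _ : injective (@Some 'I_k))).
  apply/subset_leq_card/subsetP => _ /imsetP[i iU ->].
  move: iU; rewrite inE => /existsP[w /andP[wS /andP[vw /eqP cw]]].
  by apply/imsetP; exists w; rewrite ?inE ?wS // cw valK.
rewrite -[X in _ < X](card_ord k) -cardsT => used_lt.
have [i iU]: exists i, i \notin used.
  apply/existsP; rewrite -[X in is_true X]negbK negb_exists; apply/negP => /forallP all_used.
  move: used_lt; rewrite ltnNge => /negP; apply; apply/subset_leq_card/subsetP => i _.
  by have := all_used i; rewrite negbK.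
have i_ok w : w \in S -> r v w -> c w != i.
  move=> wS vw; apply: contra iU => /eqP cw; rewrite inE; apply/existsP; exists w.
  by rewrite wS vw cw eqxx.
exists (fun e => if e == v then val i else c e) => [e eS|e f eS fS ef] /=.
  by case: (eqVneq e v) => [_|ne]; rewrite ?ltn_ord // c_lt // !inE ne.
case: (eqVneq e v) (eqVneq f v) => [Ee|ne] [Ef|nf].
- by rewrite Ee Ef r_irr in ef.
- by rewrite eq_sym i_ok // -Ee.
- by rewrite i_ok // r_sym -Ef.
- by apply: c_ok; rewrite ?inE ?ne ?nf.
Qed.

(** No conflict crosses from [O] to the rest of [S], so two colorings that reuse the same colors can
    be glued. *)
Lemma colorable_component (k : nat) (S O : {set T}) :
  symmetric r -> {in O & S :\: O, forall e f, ~~ r e f} ->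
  colorable k O -> colorable k (S :\: O) -> colorable k S.
Proof.
move=> r_sym sep [c c_lt c_ok] [b b_lt b_ok].
exists (fun e => if e \in O then c e else b e) => [e eS|e f eS fS ef] /=.
  by case: ifPn => eO; [exact: c_lt | apply: b_lt; rewrite inE eO].
case: ifPn => eO; case: ifPn => fO; last 1 first.
- by apply: b_ok; rewrite ?inE ?eO ?fO.
- exact: c_ok.
- by rewrite (negbTE (sep e f _ _)) ?inE ?fO ?eO in ef.
- by rewrite r_sym (negbTE (sep f e _ _)) ?inE ?fO ?eO in ef.
Qed.

End Colorable.

(** * Numerical estimates *)

Lemma leq_card_bigcup (I T : finType) (D : {set I}) (F : I -> {set T}) :
  #|\bigcup_(i in D) F i| <= \sum_(i in D) #|F i|.
Proof.
elim/big_rec2: _ => [|i n A _ IH]; first by rewrite cards0.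
by apply: leq_trans (leq_card_setU _ _) _; rewrite leq_add2l.
Qed.

(** Read [d] as the maximum degree, [a] and [b] as the degrees of the ends of an edge, [t] and [D]
    as the numbers of its common and private neighbours, [p] as the number of edges between these
    two sets, [q] as twice the number of edges among the common ones, and [N] as the number of
    conflicts. *)
Lemma conflict_arith (d a b t D p q N : nat) :
  d <= 5 -> 0 < a -> 0 < b -> a <= d -> b <= d -> D + 2 * t + 2 = a + b ->
  p <= t * D -> q <= t * t.-1 -> p + q <= t * (d - 2) ->
  2 * N <= 2 * (a + b - 2) + 2 * p + q ->
  N <= (d * d.+1)./2 /\ ((d * d.+1)./2 <= N -> a = 5 /\ t = 3 \/
   d = 4 /\ [/\ a = 4, b = 4, t = 2, p = 4 & D = 2]).
Proof.
move=> d5 a0 b0 ha hb hD hp hq hpq hN.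
have tb : t <= 4 by lia.
(* With [d] and [t] numerals, the products become linear. *)
case: d d5 ha hb hpq => [|[|[|[|[|[|d]]]]]] // _ ha hb hpq;
  case: t tb hp hq hpq hD => [|[|[|[|[|t]]]]] // _ hp hq hpq hD; rewrite /= in hq *;
  try (split; [lia|move=> hk; exfalso; lia]);
  split; try lia; move=> hk; (try by left; split; lia); by right; split=> //; split; lia.
Qed.

(** * Edges and the handshake lemma *)

Section Conflict.
Variable G : sgraph.
Implicit Types (x y z u v w : G) (e f : {set G}) (S : {set {set G}}).

Definition nbh x : {set G} := [set y | adj x y].

Lemma in_nbh x y : (y \in nbh x) = adj x y.
Proof. by rewrite inE. Qed.

Lemma adjC x y : adj x y = adj y x.
Proof. exact: adj_sym. Qed.

Lemma adj_neq x y : adj x y -> x != y.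
Proof. by apply: contraTneq => ->; rewrite adj_irr. Qed.

Lemma edgesP e : reflect (exists x y, adj x y /\ e = [set x; y]) (e \in edges G).
Proof.
rewrite inE; apply: (iffP existsP) => [[x /existsP[y /andP[xy /eqP ->]]]|[x [y [xy ->]]]].
  by exists x, y.
by exists x; apply/existsP; exists y; rewrite xy eqxx.
Qed.

Lemma set2_edge x y : ([set x; y] \in edges G) = adj x y.
Proof.
apply/edgesP/idP => [[u [v [uv E]]]|xy]; last by exists x, y.
have := set21 u v; have := set22 u v; rewrite -E => /set2P[]vE /set2P[]uE; move: uv;
  by rewrite uE vE ?adj_irr // adjC.
Qed.

Lemma set2_inj x : injective (fun y => [set x; y]).
Proof.
move=> y z E; have : y \in [set x; z] by rewrite -E set22.
by case/set2P => // yx; have := set22 x z; rewrite -E yx => /set2P[].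
Qed.

Lemma card_edge e : e \in edges G -> #|e| = 2.
Proof. by case/edgesP => x [y [xy ->]]; rewrite cards2 adj_neq. Qed.

Lemma edge_mem e x : e \in edges G -> x \in e -> exists2 y, adj x y & e = [set x; y].
Proof.
case/edgesP => u [v [uv ->]]; rewrite !inE => /orP[] /eqP ->; first by exists v.
by exists u; rewrite 1?adjC // setUC.
Qed.

(** Double counting of the incidences between vertices of [W] and edges inside [W]. *)
Lemma handshake (W : {set G}) :
  \sum_(u in W) #|nbh u :&: W| = 2 * #|[set e in edges G | e \subset W]|.
Proof.
set I := [set e in _ | _].
transitivity (\sum_(u in W) \sum_(e in I | u \in e) 1).
  apply: eq_bigr => u uW; rewrite sum1dep_card -(card_imset _ (@set2_inj u)).
  apply: eq_card => e; rewrite inE; apply/imsetP/andP => [[v]|[]].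
    rewrite in_setI in_nbh => /andP[uv vW] ->; split; last exact: set21.
    by rewrite inE set2_edge uv subUset !sub1set uW vW.
  rewrite inE => /andP[eE eW] ue; have [v uv E] := edge_mem eE ue; exists v => //.
  by move: eW; rewrite !inE E subUset !sub1set => /andP[_ ->]; rewrite uv.
rewrite (exchange_big_dep (mem I)) /=; last by move=> u e _ /andP[].
rewrite mulnC -sum_nat_const; apply: eq_bigr => e eI; move: (eI); rewrite inE => /andP[eE eW].
rewrite sum1dep_card -(card_edge eE); apply: eq_card => u; rewrite inE eE eW.
by apply: andb_idl => ue; apply: (subsetP eW).
Qed.

(** * The conflict graph on edges *)

(* [e] and [f] are the two disjoint edges xy and uv of a diamond whose vertices of degree 3
   are x and u; [y = v] is not excluded, but then [e] and [f] share an end. *)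
Definition opposite : rel {set G} := fun e f =>
  [exists x, exists y, exists u, exists v,
    [&& e == [set x; y], f == [set u; v], adj x u, adj x v & adj y u]].

Lemma oppositeP e f : reflect
  (exists x y u v, [/\ e = [set x; y], f = [set u; v], adj x u, adj x v & adj y u])
  (opposite e f).
Proof.
apply: (iffP existsP) => [[x /existsP[y /existsP[u /existsP[v]]]]|[x [y [u [v [-> -> xu xv yu]]]]]].
  by case/and5P => /eqP -> /eqP -> xu xv yu; exists x, y, u, v.
exists x; apply/existsP; exists y; apply/existsP; exists u; apply/existsP; exists v.
by rewrite !eqxx xu xv.
Qed.

Lemma opposite_sym : symmetric opposite.
Proof.
suff imp e f : opposite e f -> opposite f e by move=> e f; apply/idP/idP; apply: imp.
case/oppositeP => x [y [u [v [-> -> xu xv yu]]]]; apply/oppositeP; exists u, v, x, y.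
by rewrite adjC xu adjC yu adjC xv.
Qed.

Definition conflict : rel {set G} := fun e f =>
  (e != f) && ((e :&: f != set0) || opposite e f).

Lemma conflict_sym : symmetric conflict.
Proof. by move=> e f; rewrite /conflict eq_sym setIC opposite_sym. Qed.

Lemma conflict_irr : irreflexive conflict.
Proof. by move=> e; rewrite /conflict eqxx. Qed.

(** Two edges of a diamond either share an end or are opposite, so they always conflict and get
    different colors. *)
Lemma D_colorable_conflict (k : nat) : colorable conflict k (edges G) -> D_colorable G k.
Proof.
case=> c c_lt c_ok.
apply/existsP; exists [ffun e : edge G => Ordinal (c_lt (val e) (valP e))].
set C := finfun _.
have Cne (e f : edge G) : conflict (val e) (val f) -> C e != C f.
  by move=> ef; rewrite !ffunE -val_eqE; apply: c_ok; rewrite ?(valP e) ?(valP f).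
apply/andP; split.
  apply/forallP => e; apply/forallP => f; apply/implyP => /andP[ne sh].
  by apply: Cne; rewrite /conflict (inj_eq val_inj) ne sh.
apply/forallP => V; apply/forallP => F; apply/implyP => /andP[/forallP sub /existsP[h]].
case/and3P => /injectiveP h_inj _ /forallP h_adj.
have hP (a b : {x | x \in V}) : adj (h a) (h b) = sub_adj F a b.
  by have /forallP/(_ b)/eqP := h_adj a.
have subE a b : sub_adj F a b -> adj (val a) (val b).
  by case/existsP => e /andP[_ /eqP E]; rewrite -set2_edge -E (valP e).
have ends (e : edge G) : e \in F -> exists a b : {x | x \in V},
    val e = [set val a; val b] /\ sub_adj F a b.
  move=> eF; have /implyP/(_ eF) eV := sub e; have /edgesP[x [y [xy E]]] := valP e.
  move: eV; rewrite E subUset !sub1set => /andP[xV yV].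
  exists (exist _ x xV), (exist _ y yV); split=> //; apply/existsP; exists e.
  by rewrite eF E eqxx.
apply/dinjectiveP => e f eF fF Cef; apply: contra_eq Cef => ne; apply: Cne.
rewrite /conflict (inj_eq val_inj) ne /=; have [//|disj] := boolP (_ != _) .
have [a [b [Ee ab]]] := ends e eF; have [a' [b' [Ef ab']]] := ends f fF.
have h_ne (u v : {x | x \in V}) : val u \in val e -> val v \in val f -> h u != h v.
  move=> ue vf; rewrite (inj_eq h_inj) -val_eqE; apply: contraNneq disj => E.
  by apply/set0Pn; exists (val u); rewrite inE ue E.
(* Two disjoint edges of a diamond miss at most one of the four edges joining them. *)
have cross : [forall i : 'I_4, forall j : 'I_4, forall k : 'I_4, forall l : 'I_4,
   [&& diamond_adj i j, diamond_adj k l, i != k, i != l, j != k & j != l] ==>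
   [|| [&& diamond_adj i k, diamond_adj i l & diamond_adj j k],
       [&& diamond_adj i k, diamond_adj i l & diamond_adj j l],
       [&& diamond_adj j k, diamond_adj j l & diamond_adj i k] |
       [&& diamond_adj j k, diamond_adj j l & diamond_adj i l]]].
  by do 4![apply/forallP; case=> [[|[|[|[|//]]]] ?]].
have hP' (a1 b1 : {x | x \in V}) : diamond_adj (h a1) (h b1) = sub_adj F a1 b1 by rewrite -hP.
have := cross => /forallP/(_ (h a))/forallP/(_ (h b))/forallP/(_ (h a'))/forallP/(_ (h b'))/implyP.
rewrite !hP' ab ab' !h_ne ?Ee ?Ef ?set21 ?set22 //= => /(_ isT).
(* Each alternative singles out the end of [e] and the end of [f] that have degree 3 in the
   diamond. *)
by case/or4P => /and3P[/subE h1 /subE h2 /subE h3]; apply/oppositeP;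
  [exists (val a), (val b), (val a'), (val b')
  |exists (val a), (val b), (val b'), (val a')
  |exists (val b), (val a), (val a'), (val b')
  |exists (val b), (val a), (val b'), (val a')]; split; rewrite // setUC.
Qed.

(** * Counting the conflicts of one edge *)

Definition common x y : {set G} := nbh x :&: nbh y.

(* The vertices other than x and y that are adjacent to exactly one of them. *)
Definition private x y : {set G} := ((nbh x :|: nbh y) :\: common x y) :\: [set x; y].

(** Inclusion-exclusion for the two neighbourhoods; the summand 2 accounts for [x] and [y]
    themselves. *)
Lemma card_private x y : adj x y ->
  #|private x y| + 2 * #|common x y| + 2 = degree x + degree y.
Proof.
move=> xy; have xyD : [set x; y] \subset (nbh x :|: nbh y) :\: common x y.
  by rewrite subUset !sub1set !inE !adj_irr xy adjC xy.
have TU : common x y \subset nbh x :|: nbh y by rewrite subIset // subsetUl.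
have := subset_leq_card xyD; rewrite /private (cardsDS xyD) (cardsDS TU) cards2 (adj_neq xy).
have := cardsUI (nbh x) (nbh y); have := subset_leq_card TU.
rewrite /degree -/(nbh x) -/(nbh y) -/(common x y); lia.
Qed.

(** A conflicting edge disjoint from xy has one end adjacent to both [x] and [y] and the other
    adjacent to at least one of them, so it joins a common neighbour to a private one ([P]) or lies
    among the common ones ([Q]). The factor 2 comes from counting [Q] by the handshake lemma. *)
Lemma card_conflict x y S : adj x y -> S \subset edges G ->
  2 * #|[set f in S | conflict [set x; y] f]| <=
    2 * (degree x + degree y - 2) + 2 * (\sum_(u in common x y) #|nbh u :&: private x y|)
    + \sum_(u in common x y) #|nbh u :&: common x y|.
Proof.
move=> xy SE.
pose star x y := (fun w => [set x; w]) @: (nbh x :\ y).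
have star_card a b : adj a b -> #|star a b| = degree a - 1.
  move=> ab; rewrite card_imset ?(cardsD1 b (nbh a)) ?in_nbh; last exact: set2_inj.
  by rewrite /degree -/(nbh a) (cardsD1 b (nbh a)) in_nbh ab add1n subn1.
pose P := \bigcup_(u in common x y) (fun w => [set u; w]) @: (nbh u :&: private x y).
pose Q := [set e in edges G | e \subset common x y].
have cover : [set f in S | conflict [set x; y] f] \subset star x y :|: star y x :|: P :|: Q.
  apply/subsetP => f; rewrite inE => /andP[/(subsetP SE) fE /andP[ne cf]].
  have [/set0Pn[w]|disj] := boolP ([set x; y] :&: f != set0).
    rewrite inE => /andP[/set2P[]-> wf]; have [z wz E] := edge_mem fE wf.
    - have nz : z != y by apply: contraNneq ne => <-; rewrite E.
      by rewrite !in_setU (_ : f \in star x y) // E; apply: imset_f; rewrite !inE nz wz.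
    - have nz : z != x by apply: contraNneq ne => <-; rewrite E setUC.
      by rewrite !in_setU (_ : f \in star y x) ?orbT // E; apply: imset_f; rewrite !inE nz wz.
  rewrite (negbTE disj) /= in cf.
  have xf : x \notin f by apply: contraNN disj => xf; apply/set0Pn; exists x; rewrite !inE eqxx.
  have yf : y \notin f by apply: contraNN disj => yf; apply/set0Pn; exists y; rewrite !inE eqxx orbT.
  have main u v : f = [set u; v] -> u \in common x y -> v \in nbh x :|: nbh y ->
      f \in star x y :|: star y x :|: P :|: Q.
    move=> E uT vN; have uv : adj u v by rewrite -set2_edge -E.
    have [vT|vT] := boolP (v \in common x y).
      by apply/setUP; right; rewrite inE fE E subUset !sub1set uT vT.
    apply/setUP; left; apply/setUP; right; apply/bigcupP; exists u => //.
    rewrite E; apply: imset_f; rewrite in_setI in_nbh uv in_setD in_setD vT vN.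
    move: xf yf; rewrite E !inE !negb_or => /andP[_ xv] /andP[_ yv].
    by rewrite ![v == _]eq_sym xv yv.
  case/oppositeP: cf => a [b [u [v [E Ef au av bu]]]].
  (* The ends of xy may play the two roles in [opposite] in either order. *)
  have abE : (a = x /\ b = y) \/ (a = y /\ b = x).
    have [aE|aE] : a = x \/ a = y by apply/set2P; rewrite E set21.
      by left; split=> //; apply: (@set2_inj x); rewrite E aE.
    by right; split=> //; apply: (@set2_inj y); rewrite -aE -E setUC aE.
  by case: abE => -[Ea Eb]; rewrite Ea Eb in au av bu;
    apply: (main u v Ef); rewrite !inE ?au ?bu ?av ?orbT.
have dx : 0 < degree x by apply/card_gt0P; exists y; rewrite inE.
have dy : 0 < degree y by apply/card_gt0P; exists x; rewrite inE adjC.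
rewrite (handshake (common x y)) -/Q -!mulnDr leq_mul2l /=.
apply: leq_trans (subset_leq_card cover) _.
apply: leq_trans (leq_card_setU _ _) _; rewrite leq_add2r.
apply: leq_trans (leq_card_setU _ _) _; apply: leq_add; last first.
  apply: leq_trans (leq_card_bigcup _ _) _.
  by apply: leq_sum => u _; apply: leq_imset_card.
apply: leq_trans (leq_card_setU _ _) _; rewrite !star_card // 1?adjC //; lia.
Qed.

Lemma degree_le x : degree x <= max_degree G.
Proof. exact: leq_bigmax. Qed.

Lemma sum_private_le x y :
  \sum_(u in common x y) #|nbh u :&: private x y| <= #|common x y| * #|private x y|.
Proof.
rewrite -sum_nat_const; apply: leq_sum => u _; apply/subset_leq_card/subsetIr.
Qed.

Lemma sum_common_le x y :
  \sum_(u in common x y) #|nbh u :&: common x y| <= #|common x y| * #|common x y|.-1.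
Proof.
rewrite -sum_nat_const; apply: leq_sum => u uT.
rewrite [in X in _ <= X](cardsD1 u) uT /=; apply/subset_leq_card/subsetP => v.
rewrite in_setI in_nbh in_setD1 => /andP[uv ->].
by rewrite eq_sym adj_neq.
Qed.

(** A common neighbour spends two of its edges on [x] and [y]. *)
Lemma sum_common_private_le x y : adj x y ->
  \sum_(u in common x y) #|nbh u :&: private x y|
    + \sum_(u in common x y) #|nbh u :&: common x y|
  <= #|common x y| * (max_degree G - 2).
Proof.
move=> xy; rewrite -big_split -sum_nat_const /=; apply: leq_sum => u uT.
rewrite -cardsUI (_ : (_ :&: private x y) :&: _ = set0) ?cards0 ?addn0; last first.
  apply/setP => v; rewrite in_set0; apply/negbTE/negP.
  by move=> /setIP[/setIP[_ /setDP[/setDP[_ /negP vT] _]] /setIP[_ /vT]].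
have xyN : [set x; y] \subset nbh u.
  by move: uT; rewrite subUset !sub1set !inE ![adj u _]adjC.
apply: leq_trans (_ : #|nbh u :\: [set x; y]| <= _).
  apply/subset_leq_card/subsetP => v; rewrite !inE.
  have [->|_] := eqVneq v x; first by rewrite /= adj_irr !andbF.
  have [->|_] := eqVneq v y; first by rewrite /= adj_irr !andbF.
  by case: (adj u v).
by rewrite (cardsDS xyN) cards2 (adj_neq xy) leq_sub2r // degree_le.
Qed.

(** In an octahedron the common neighbours of adjacent [x] and [y] form an antipodal pair, and the
    private ones are the antipodes of [x] and [y]. *)
Definition octahedral x y : Prop :=
  [/\ degree x = 4, degree y = 4, #|common x y| = 2
    & {in common x y & private x y, forall u v, adj u v}].

Lemma conflict_bound x y S : max_degree G <= 5 -> adj x y -> S \subset edges G ->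
  let k := (max_degree G * (max_degree G).+1)./2 in
  let N := #|[set f in S | conflict [set x; y] f]| in
  N <= k /\ (k <= N -> degree x = 5 /\ #|common x y| = 3 \/ max_degree G = 4 /\ octahedral x y).
Proof.
move=> d5 xy SE k N.
have := card_conflict xy SE; rewrite -/N.
have := sum_common_private_le xy; have := sum_common_le x y; have := sum_private_le x y.
have := card_private xy; have := degree_le x; have := degree_le y.
have dx : 0 < degree x by apply/card_gt0P; exists y; rewrite inE.
have dy : 0 < degree y by apply/card_gt0P; exists x; rewrite inE adjC.
rewrite /octahedral.
have pE : \sum_(u in common x y) #|nbh u :&: private x y| = 4 -> #|common x y| = 2 ->
    #|private x y| = 2 -> {in common x y & private x y, forall u v, adj u v}.
  move=> p4 t2 D2 u v uT vD.
  have full : \sum_(u in common x y) #|nbh u :&: private x y|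
      == \sum_(u in common x y) #|private x y| by rewrite p4 sum_nat_const t2 D2.
  (* A sum that attains its termwise upper bound attains it in every term. *)
  move: full; have/leqif_sum -> : forall u, u \in common x y ->
      #|nbh u :&: private x y| <= #|private x y| ?= iff (private x y \subset nbh u).
    move=> u' _; split; first exact/subset_leq_card/subsetIr.
    by rewrite (sameP setIidPr eqP) eqEcard subsetIr /= eqn_leq subset_leq_card ?subsetIr.
  by move=> /forall_inP/(_ u uT)/subsetP/(_ v vD); rewrite in_nbh.
move: pE.
set p := \sum_(u in _) #|nbh u :&: private _ _|; set q := \sum_(u in _) _.
move: p q (degree x) (degree y) dx dy => p q a b a0 b0 pE.
rewrite /k; move: (max_degree G) d5 => d d5.
move: #|private x y| #|common x y| pE => D t pE.
move=> hb ha hD hp hq hpq hN.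
have R := conflict_arith d5 a0 b0 ha hb hD hp hq hpq hN.
split; first exact: R.1.
move=> /R.2[[? ?]|[d4 [a4 b4 t2 p4 D2]]]; first by left.
by right; do 2!split=> //; exact: pE.
Qed.

(** Already inside [S] the edge [e] has as many conflicts as [conflict_bound] allows among all
    edges, so none is left outside [S]. *)
Lemma closed_saturated S e f : max_degree G <= 5 -> S \subset edges G ->
  e \in S -> (max_degree G * (max_degree G).+1)./2 <= #|[set f in S | conflict e f]| ->
  f \in edges G -> conflict e f -> f \in S.
Proof.
move=> d5 SE eS kN fE ef; have /edgesP[x [y [xy Ee]]] := subsetP SE e eS.
have sub : [set f in S | conflict e f] \subset [set f in edges G | conflict e f].
  by apply/subsetP => h; rewrite !in_set => /andP[/(subsetP SE)]; rewrite in_set => ->.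
have [le _] := conflict_bound d5 xy (subxx (edges G)); rewrite -Ee in le.
have := eqEcard [set f in S | conflict e f] [set f in edges G | conflict e f].
rewrite sub (leq_trans le kN) => /eqP/setP/(_ f); rewrite in_set [in RHS]in_set fE ef.
by case/andP.
Qed.

(** * Octahedra with all degrees 4, and their coloring *)

Definition axis_apart (i j : 'I_6) : bool := i./2 != j./2.

Section Octahedron.
Variable g : 'I_6 -> G.
Hypothesis g_inj : injective g.
Hypothesis g_adj : forall i j, axis_apart i j -> adj (g i) (g j).
Hypothesis g_deg : forall i, degree (g i) = 4.

(** The four neighbours inside the image of [g] exhaust the degree, so no edge leaves the image. *)
Lemma octahedron_nbh i v : adj (g i) v -> exists2 j, v = g j & axis_apart i j.
Proof.
have sub : g @: [set j | axis_apart i j] \subset nbh (g i).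
  by apply/subsetP => _ /imsetP[j ij ->]; rewrite in_nbh g_adj // -[axis_apart _ _]in_set.
have : g @: [set j | axis_apart i j] == nbh (g i).
  rewrite eqEcard sub [X in X <= _](g_deg i) card_imset // cardE -sum1_size.
  rewrite big_enum_cond big_mkcond /= !big_ord_recl big_ord0 !inE.
  by case: i {sub} => [[|[|[|[|[|[|//]]]]]] ?].
by move=> /eqP/setP/(_ v); rewrite in_nbh => + iv; rewrite iv => /imsetP[j]; rewrite inE; exists j.
Qed.

Lemma octahedron_adj i j : adj (g i) (g j) = axis_apart i j.
Proof.
by apply/idP/idP => [/octahedron_nbh[k /g_inj ->]|/g_adj].
Qed.

Definition octahedron_edges : {set {set G}} :=
  [set e in edges G | e \subset g @: setT].

Lemma octahedron_edgeP x y : [set x; y] \in octahedron_edges ->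
  exists i j, [/\ x = g i, y = g j & axis_apart i j].
Proof.
rewrite inE set2_edge subUset !sub1set => /andP[xy /andP[/imsetP[i _ xE] /imsetP[j _ yE]]].
by exists i, j; rewrite -octahedron_adj -xE -yE.
Qed.

Lemma octahedron_edge_meet i e : e \in edges G -> g i \in e -> e \in octahedron_edges.
Proof.
move=> eE ie; rewrite inE eE; have [v iv ->] := edge_mem eE ie.
have [j -> _] := octahedron_nbh iv.
by rewrite subUset !sub1set !imset_f.
Qed.

(** In both kinds of conflict [f] has an end in the image of [g]: a shared end, or a neighbour of an
    end of [e]. *)
Lemma octahedron_closed e f : e \in octahedron_edges -> f \in edges G ->
  conflict e f -> f \in octahedron_edges.
Proof.
move=> eO fE /andP[_ /orP[/set0Pn[w /setIP[we wf]]|/oppositeP[x [y [u [v [Ee Ef xu xv yu]]]]]]].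
  move: eO; rewrite inE => /andP[_ /subsetP/(_ w we)/imsetP[i _ wE]].
  by apply: (@octahedron_edge_meet i); rewrite -?wE.
move: eO; rewrite Ee => /octahedron_edgeP[i [j [xE _ _]]]; rewrite xE in xu.
have [k uE _] := octahedron_nbh xu.
by apply: (@octahedron_edge_meet k); rewrite // -uE Ef set21.
Qed.

(* On the octahedron {0,1} * {2,3} * {4,5} (antipodes paired), an edge is
   colored by the axis it avoids and by whether its ends have equal parity:
   each color is used on an edge and on its antipode only. *)
Definition octahedron_color (i j : nat) : nat :=
  2 * (i./2 + j./2).-1 + odd (i + j).

(** Stated with booleans over [iota], so that evaluation decides it: edges of equal color neither
    meet, unless equal, nor are opposite. *)
Lemma octahedron_color_check : all (fun i => all (fun j => all (fun k => all (fun l =>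
  ((i./2 != j./2) && (k./2 != l./2) && (octahedron_color i j == octahedron_color k l)) ==>
  ((i == k) ==> (j == l)) && ~~ [&& i./2 != k./2, i./2 != l./2 & j./2 != k./2])
  (iota 0 6)) (iota 0 6)) (iota 0 6)) (iota 0 6).
Proof. by vm_compute. Qed.

Lemma octahedron_colorP (i j k l : 'I_6) : axis_apart i j -> axis_apart k l ->
  octahedron_color i j = octahedron_color k l ->
  (i = k -> j = l) /\ ~~ [&& axis_apart i k, axis_apart i l & axis_apart j k].
Proof.
rewrite /axis_apart => ij kl E.
have mem (a : 'I_6) : val a \in iota 0 6 by rewrite mem_iota /= add0n ltn_ord.
have := octahedron_color_check => /allP/(_ _ (mem i))/allP/(_ _ (mem j)).
move=> /allP/(_ _ (mem k))/allP/(_ _ (mem l)).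
rewrite ij kl E eqxx => /andP[/implyP h ->]; split=> // ik.
by apply/val_inj/eqP/h/eqP; rewrite ik.
Qed.

Lemma octahedron_colorable k : 6 <= k -> colorable conflict k octahedron_edges.
Proof.
move=> k6.
(* [octahedron_color] depends only on sums over the two ends, so it can be read off the unordered
   edge. *)
pose c (e : {set G}) := let s := [set i | g i \in e] in
  2 * (\sum_(i in s) i./2).-1 + odd (\sum_(i in s) i).
have cE i j : axis_apart i j -> c [set g i; g j] = octahedron_color i j.
  move=> ij; have ne : i != j by apply: contraNneq ij => ->; rewrite /axis_apart eqxx.
  rewrite /c (_ : [set i0 | _] = [set i; j]); last first.
    by apply/setP => m; rewrite !inE !(inj_eq g_inj).
  by rewrite !big_setU1 ?inE //= !big_set1.
exists c => [e eO|e f eO fO].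
  have /edgesP[x [y [_ E]]] : e \in edges G by move: eO; rewrite inE => /andP[].
  move: eO; rewrite E => /octahedron_edgeP[i [j [-> -> ij]]]; rewrite cE //.
  apply: leq_trans k6; case: i j ij => [[|[|[|[|[|[|//]]]]]] ?] [[|[|[|[|[|[|//]]]]]] ?]; by vm_compute.
have eE : e \in edges G by move: eO; rewrite inE => /andP[].
have fE : f \in edges G by move: fO; rewrite inE => /andP[].
case/andP => ne /orP[/set0Pn[w /setIP[we wf]]|/oppositeP[x [y [u [v [Ee Ef xu xv yu]]]]]].
  have [x _ Ex] := edge_mem eE we; have [y _ Ey] := edge_mem fE wf.
  move: eO fO ne; rewrite Ex Ey => /octahedron_edgeP[i [j [wi xj ij]]].
  move=> /octahedron_edgeP[k' [l [wk yl kl]]] ne.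
  rewrite wi xj in ne *; rewrite -wi wk yl in ne *.
  rewrite wk in wi; move/g_inj: wi => ik; rewrite -ik in ij.
  rewrite !cE //; apply: contraNneq ne => /(octahedron_colorP ij kl)[-> //].
move: eO fO; rewrite Ee Ef => /octahedron_edgeP[i [j [xi yj ij]]].
move=> /octahedron_edgeP[k' [l [uk vl kl]]].
move: xu xv yu; rewrite xi yj uk vl !octahedron_adj !cE // => ik il jk.
by apply/eqP => /(octahedron_colorP ij kl)[_]; rewrite ik il jk.
Qed.

End Octahedron.

(** * Saturated edge sets and the induction *)

(** The common neighbours [z], [z'] of xy form one axis; the private neighbour [y'] of [x] is the
    antipode of [y], and the private neighbour [w] of [y] that of [x]. *)
Lemma exists_octahedron S x y : adj x y -> [set x; y] \in S ->
  (forall u v, adj u v -> [set u; v] \in S -> octahedral u v) ->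
  (forall u v w, adj u v -> adj u w -> [set u; v] \in S -> [set u; w] \in S) ->
  exists g : 'I_6 -> G, [/\ injective g, forall i j, axis_apart i j -> adj (g i) (g j),
    forall i, degree (g i) = 4 & exists i j, [set x; y] = [set g i; g j]].
Proof.
move=> xy xyS S4 Sc; have [x4 y4 t2 join] := S4 x y xy xyS.
have /cards2P[z [z' [zz' TE]]] := introT eqP t2.
have zT : z \in common x y by rewrite TE set21.
have z'T : z' \in common x y by rewrite TE set22.
have [xz yz] : adj x z /\ adj y z by move: zT; rewrite in_setI !in_nbh => /andP.
have [xz' yz'] : adj x z' /\ adj y z' by move: z'T; rewrite in_setI !in_nbh => /andP.
have other u v : adj u v -> [set u; v] \in S ->
    exists w, [/\ adj u w, w \notin nbh v & w != v].
  move=> uv uvS; have [u4 _ T2 _] := S4 u v uv uvS.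
  (* Of the four neighbours of [u], two are common with [v] and one is [v], so one remains. *)
  have : 0 < #|(nbh u :\: common u v) :\ v|.
    have Tu : common u v \subset nbh u by exact: subsetIl.
    have := cardsD1 v (nbh u :\: common u v); rewrite (cardsDS Tu) T2 -[#|nbh u|]/(degree u) u4.
    by case: (_ \in _) => /= E; move: E; case: #|_|.
  case/card_gt0P => w; rewrite in_setD1 in_setD in_setI !in_nbh => /and3P[wv nT uw].
  by exists w; rewrite wv in_nbh; split=> //; move: nT; rewrite uw.
have [y' [xy' yy' y'y]] := other x y xy xyS.
have [||w [yw xw wx]] := other y x; rewrite ?[adj y x]adjC ?[[set y; x]]setUC //.
rewrite in_nbh in yy'; rewrite in_nbh in xw.
have y'D : y' \in private x y.
  by rewrite !inE xy' (negbTE yy') (negbTE y'y) eq_sym (negbTE (adj_neq xy')).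
have wD : w \in private x y.
  by rewrite !inE yw (negbTE xw) (negbTE wx) eq_sym (negbTE (adj_neq yw)).
have [zy' zw z'y' z'w] : [/\ adj z y', adj z w, adj z' y' & adj z' w] by split; apply: join.
have xzS : [set x; z] \in S by exact: Sc xyS.
have [_ _ _ join'] := S4 x z xz xzS.
(* This last edge comes from the edge xz, for which [y'] is common and [w] private. *)
have y'w : adj y' w.
  apply: join'; first by rewrite !inE xy' zy'.
  by rewrite !inE zw (negbTE xw) (negbTE wx) eq_sym (negbTE (adj_neq zw)).
have deg4 u v : adj u v -> [set u; v] \in S -> degree u = 4 /\ degree v = 4.
  by move=> uv uvS; have [] := S4 u v uv uvS.
have [yx yxS] : adj y x /\ [set y; x] \in S by rewrite adjC setUC.
(* Antipodes stand in consecutive positions, to match [axis_apart]. *)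
pose s := [:: x; w; y; y'; z; z'].
have us : uniq s.
  have ne (a b : G) : adj a b -> (a == b) = false by move=> ab; apply/negbTE/adj_neq.
  have xw_ne : (x == w) = false by rewrite eq_sym (negbTE wx).
  have yy'_ne : (y == y') = false by rewrite eq_sym (negbTE y'y).
  by rewrite /= !inE xw_ne yy'_ne (negbTE zz') !ne // adjC.
exists (fun i : 'I_6 => nth x s i); split.
- by move=> i j /eqP; rewrite nth_uniq ?ltn_ord // => /eqP/val_inj.
- by case=> [[|[|[|[|[|[|//]]]]]] ?] [[|[|[|[|[|[|//]]]]]] ?] //= _; rewrite // adjC.
- case=> [[|[|[|[|[|[|//]]]]]] ?] //=.
  + exact: (deg4 _ _ yw (Sc y x w yx yw yxS)).2.
  + exact: (deg4 _ _ xy' (Sc x y y' xy xy' xyS)).2.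
  + exact: (deg4 _ _ xz xzS).2.
  + exact: (deg4 _ _ xz' (Sc x y z' xy xz' xyS)).2.
by exists ord0, (inord 2); rewrite /= inordK.
Qed.

(** Stated for every set of edges, so that induction on its size can remove one edge or a whole
    octahedron. *)
Lemma edges_colorable S : max_degree G <= 5 -> S \subset edges G ->
  colorable conflict (max_degree G * (max_degree G).+1)./2 S.
Proof.
move=> d5; set k := _./2.
elim/(well_founded_ind (Wf_nat.well_founded_ltof _ (fun A : {set {set G}} => #|A|))): S.
rewrite /Wf_nat.ltof => S IH SE.
have sub A : S :\: A \subset edges G by apply: subset_trans SE; exact: subsetDl.
have [/exists_inP[e eS low]|high] := boolP [exists e in S, #|[set f in S | conflict e f]| < k].
  apply: colorable_setD1 low _; [exact: conflict_sym | exact: conflict_irr |].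
  by apply: IH => //; apply/ltP; rewrite [X in _ < X](cardsD1 e) eS.
have [->|[e eS]] := set_0Vmem S.
  by exists (fun => 0) => [e|e f]; rewrite in_set0.
have big f : f \in S -> k <= #|[set h in S | conflict f h]|.
  by move=> fS; move: high; rewrite negb_exists_in => /forall_inP/(_ f fS); rewrite -leqNgt.
have closed u v w : adj u v -> adj u w -> [set u; v] \in S -> [set u; w] \in S.
  move=> uv uw uvS; have [<- //|ne] := eqVneq [set u; v] [set u; w].
  apply: closed_saturated (big _ uvS) _ _ => //; first by rewrite set2_edge.
  by rewrite /conflict ne; apply/orP; left; apply/set0Pn; exists u; rewrite !inE eqxx.
have /edgesP[x [y [xy E]]] := subsetP SE e eS; rewrite {}E in eS.
have extr u v (uv : adj u v) (uvS : [set u; v] \in S) :=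
  (conflict_bound d5 uv SE).2 (big _ uvS).
have [[x5 t3]|[d4 _]] := extr x y xy eS.
  have d5' : max_degree G = 5 by apply/eqP; rewrite eqn_leq d5 -x5 degree_le.
  (* Every edge at [x] is in [S] and thus extremal, so each of the 5 neighbours of [x] has 3
     neighbours among them; the degree sum 15 is odd. *)
  have := handshake (nbh x); rewrite (eq_bigr (fun => 3)) => [|u xu].
    by rewrite sum_nat_const -[#|nbh x|]/(degree x) x5; lia.
  rewrite in_nbh in xu; have [[_ <-]|[]] := extr x u xu (closed _ _ _ xy xu eS).
    by rewrite setIC.
  by rewrite d5'.
have [|g [g_inj g_adj g_deg [i [j gE]]]] := exists_octahedron xy eS _ closed.
  move=> u v uv uvS; have [[u5 _]|[_ //]] := extr u v uv uvS.
  by have := degree_le u; rewrite u5 d4.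
have eO : [set x; y] \in octahedron_edges g.
  by rewrite inE set2_edge xy gE subUset !sub1set !imset_f.
apply: (@colorable_component _ _ _ _ (octahedron_edges g)).
- exact: conflict_sym.
- move=> e' f eO' /setDP[/(subsetP SE) fE]; apply: contra.
  exact: (octahedron_closed g_inj g_adj g_deg eO' fE).
(* Here [k] is 10, which leaves room for the 6 colors. *)
- by apply: octahedron_colorable => //; rewrite /k d4.
apply: IH => //; apply/ltP/proper_card/properP; split; first exact: subsetDl.
by exists [set x; y] => //; rewrite inE eO.
Qed.

End Conflict.

(** * The bound over the rationals *)

Local Open Scope ring_scope.

Theorem theorem1p3 (G : sgraph) (hG : (max_degree G <= 5)%N) :
  ((D_chromatic_index G)%:R : rat) <=
    1 / 2 * (max_degree G)%:R ^+ 2 + 1 / 2 * (max_degree G)%:R.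
Proof.
have le : (D_chromatic_index G <= (max_degree G * (max_degree G).+1)./2)%N.
  rewrite /D_chromatic_index; case: ex_minnP => m _; apply.
  exact/D_colorable_conflict/edges_colorable.
have := le; rewrite -(Num.Theory.ler_nat rat) => /Order.POrderTheory.le_trans; apply.
(* For each of the six possible degrees this is a comparison of numerals. *)
by move: (max_degree G) hG => [|[|[|[|[|[|]]]]]].
Qed.
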